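(* For $\epsilon>0$ let $$f(\epsilon,t)=\epsilon+\sum_{n=1}^{\infty}a_n(\epsilon)\,t^{n/3}$$ be the solution of $$\frac{df(\epsilon,t)}{dt}=\frac{2}{f(\epsilon,t)-\sqrt[3]{t}},\qquad f(\epsilon,0)=\epsilon,$$ that is holomorphic with respect to $\tau=\sqrt[3]{t}$ in a neighborhood of $\tau=0$. Then this series converges for $$|t|<\epsilon^3+o(\epsilon^3),\qquad \epsilon\to+0;$$ that is, there is a function $r(\epsilon)=\epsilon^3+o(\epsilon^3)$ as $\epsilon\to+0$ such that the series converges whenever $|t|<r(\epsilon)$.
   Context: In the variable $\tau=\sqrt[3]{t}$, the function $g(\epsilon,\tau)=f(\epsilon,\tau^3)$ is the unique solution holomorphic in $\tau$ near $0$ of $\frac{dg}{d\tau}=\frac{6\tau^2}{g-\tau}$, $g(\epsilon,0)=\epsilon$, and the series above is its Taylor series $\epsilon+\sum_{n\ge1}a_n(\epsilon)\tau^n$ at $\tau=0$; convergence for $|t|<r$ means convergence for complex $\tau$ with $|\tau|<r^{1/3}$. *)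

(* Defs.v *)
From Stdlib Require Import Reals.
From Coquelicot Require Import Coquelicot.

Open Scope R_scope.

(** With [t = tau^3] and [g tau = f (eps, tau^3)], the chain rule turns
    [df/dt = 2 / (f - t^(1/3))] into [dg/dtau = 6 tau^2 / (g - tau)].
    The derivative is the complex one (over [C_AbsRing]), so that [g] is
    holomorphic on the disc; its values outside the disc are irrelevant. *)
Definition holomorphic_solution (eps : R) (g : C -> C) : Prop :=
  g (RtoC 0) = RtoC eps /\
  exists rho : R, 0 < rho /\
    forall tau : C, Cmod tau < rho ->
      g tau <> tau /\
      is_derive g tau (RtoC 6 * tau ^ 2 / (g tau - tau))%C.

(** The constant coefficient [a 0] is [g 0], that is, [eps] when [g] is a
    solution in the sense above. *)
Definition taylor_coefficients (g : C -> C) (a : nat -> C) : Prop :=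
  exists rho : R, 0 < rho /\
    forall tau : C, Cmod tau < rho -> is_pseries a tau (g tau).

Definition little_o_at_right_0 (u v : R -> R) : Prop :=
  is_domin (U := R_NormedModule) (V := R_NormedModule) (at_right 0) v u.

(* Main.v *)
(** Restricted to real [tau], the real and imaginary parts of [g] are real power
    series, and comparing coefficients in [g g' = tau g' + 6 tau^2] bounds
    [m_n = |Re a_n| + |Im a_n|] by a quadratic recursion. Weighted by powers of
    [s], the recursion keeps the sums of [(n+1) m_(n+1) s^(n+1)] below
    [(eps - s) / 2] as soon as [24 s^3 <= (eps - s)^2], so the series converges
    for [|tau| < s]. The choice [s = eps (1 - sqrt (24 eps))] is admissible, and
    [s^3 = eps^3 + o(eps^3)]. *)

Require Import Defs.
From Stdlib Require Import Reals Lra Lia.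
From Coquelicot Require Import Coquelicot.

(** * Real and imaginary parts of complex series and derivatives *)

Lemma sum_n_C (f : nat -> C) (n : nat) :
  sum_n f n = (sum_n (fun k => Re (f k)) n, sum_n (fun k => Im (f k)) n).
Proof.
  induction n as [|n IH].
  - rewrite !sum_O. now destruct (f 0%nat).
  - rewrite !sum_Sn, IH. reflexivity.
Qed.

(** Balls of [C_NormedModule] are products of real balls, so a complex neighbourhood of the limit
    controls both parts at once. *)
Lemma is_series_C_parts (f : nat -> C) (l : C) :
  is_series (V := C_NormedModule) f l ->
  is_series (fun n => Re (f n)) (Re l) /\ is_series (fun n => Im (f n)) (Im l).
Proof.
  intros H; split; intros P [e He];
    (assert (HP : locally (T := C_NormedModule) l
       (fun z : C => Rabs (Re z - Re l) < e /\ Rabs (Im z - Im l) < e))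
       by (exists e; intros z Hz; exact Hz));
    destruct (H _ HP) as [N HN]; exists N; intros n Hn;
    specialize (HN n Hn); rewrite sum_n_C in HN; apply He; apply HN.
Qed.

Lemma pow_n_RtoC (x : R) (n : nat) :
  pow_n (K := C_AbsRing) (RtoC x) n = RtoC (x ^ n).
Proof.
  induction n as [|n IH]; [reflexivity|].
  change (Cmult (RtoC x) (pow_n (K := C_AbsRing) (RtoC x) n) = RtoC (x * x ^ n)).
  now rewrite IH, RtoC_mult.
Qed.

Lemma is_pseries_C_parts (a : nat -> C) (x : R) (l : C) :
  is_pseries (V := C_NormedModule) a (RtoC x) l ->
  is_pseries (fun n => Re (a n)) x (Re l) /\
  is_pseries (fun n => Im (a n)) x (Im l).
Proof.
  intros H; destruct (is_series_C_parts _ _ H) as [H1 H2]; split;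
    [revert H1 | revert H2]; apply is_series_ext; intros n;
    rewrite pow_n_RtoC;
    replace (pow_n (K := R_AbsRing) x n) with (x ^ n) by (symmetry; apply pow_n_pow); destruct (a n); simpl;
    unfold scal; simpl; unfold mult; simpl; ring.
Qed.

(** Only real increments are used in the complex derivative; each part of the remainder is bounded
    by its modulus through [Rmax_Cmod]. *)
Lemma is_derive_C_parts (g : C -> C) (x : R) (l : C) :
  is_derive (K := C_AbsRing) (V := C_NormedModule) g (RtoC x) l ->
  is_derive (fun y : R => Re (g (RtoC y))) x (Re l) /\
  is_derive (fun y : R => Im (g (RtoC y))) x (Im l).
Proof.
  intros [_ H].
  assert (Hx : is_filter_lim (locally (T := AbsRing_UniformSpace C_AbsRing) (RtoC x)) (RtoC x))
    by (intros P HP; exact HP).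
  specialize (H _ Hx).
  assert (HC : forall e : posreal, locally x (fun y =>
    Cmod (g (RtoC y) - g (RtoC x) - (y - x)%R * l)%C <= e * Rabs (y - x))).
  { intros e. destruct (H e) as [d Hd]. exists d. intros y Hy.
    assert (Hy' : ball (M := AbsRing_UniformSpace C_AbsRing) (RtoC x) d (RtoC y)).
    { change (Cmod (RtoC y - RtoC x)%C < d).
      rewrite <- RtoC_minus, Cmod_R. exact Hy. }
    specialize (Hd _ Hy').
    change (Cmod (g (RtoC y) - g (RtoC x) - (RtoC y - RtoC x) * l)%C
            <= e * Cmod (RtoC y - RtoC x)%C) in Hd.
    now rewrite <- RtoC_minus, Cmod_R in Hd. }
  split; (split; [apply is_linear_scal_l|]); intros y Hy e;
    rewrite <- (is_filter_lim_locally_unique _ _ Hy);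
    generalize (HC e); apply filter_imp; intros z Hz;
    (eapply Rle_trans; [|exact Hz]);
    (eapply Rle_trans; [|apply Rmax_Cmod]).
  - eapply Rle_trans; [|apply Rmax_l]. apply Req_le.
    unfold norm, minus, plus, opp, scal; simpl; unfold abs, mult; simpl.
    f_equal; unfold Re; ring.
  - eapply Rle_trans; [|apply Rmax_r]. apply Req_le.
    unfold norm, minus, plus, opp, scal; simpl; unfold abs, mult; simpl.
    f_equal; unfold Im; ring.
Qed.

(** * Real power series: radius, uniqueness of coefficients, derivative *)

(** Strictly outside the disc of convergence the terms do not tend to 0, whereas those of a
    convergent series do. *)
Lemma CV_radius_ge (a : nat -> R) (x : R) :
  ex_pseries a x -> Rbar_le (Rabs x) (CV_radius a).
Proof.
  intros H. apply Rbar_not_lt_le. intros Hlt.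
  apply (CV_disk_outside _ _ Hlt).
  apply ex_series_lim_0. revert H. apply ex_series_ext. intros n.
  replace (pow_n (K := R_AbsRing) x n) with (x ^ n) by (symmetry; apply pow_n_pow).
  unfold scal; simpl; unfold mult; simpl; ring.
Qed.

(** Convergence at [r / 2] makes both radii positive, and two series with the same sums near 0 have
    the same coefficients. *)
Lemma is_pseries_coef_unique (a b : nat -> R) (f : R -> R) (r : R) (n : nat) :
  0 < r ->
  (forall x, Rabs x < r -> is_pseries a x (f x)) ->
  (forall x, Rabs x < r -> is_pseries b x (f x)) ->
  a n = b n.
Proof.
  intros Hr Ha Hb.
  assert (Hpos : forall c, (forall x, Rabs x < r -> is_pseries c x (f x)) ->
                 Rbar_lt 0 (CV_radius c)).
  { intros c Hc. assert (Hr2 : Rabs (r / 2) = r / 2) by (apply Rabs_pos_eq; lra).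
    apply Rbar_lt_le_trans with (Rabs (r / 2)); [rewrite Hr2; simpl; lra|].
    apply CV_radius_ge. exists (f (r / 2)). apply Hc. rewrite Hr2; lra. }
  apply PSeries_ext_recip; auto.
  exists (mkposreal r Hr). intros x Hx.
  assert (Hx' : Rabs x < r).
  { change (Rabs (x - 0) < r) in Hx. now rewrite Rminus_0_r in Hx. }
  rewrite (is_pseries_unique _ _ _ (Ha x Hx')).
  now rewrite (is_pseries_unique _ _ _ (Hb x Hx')).
Qed.

Lemma is_pseries_const (c x : R) :
  is_pseries (fun n => match n with O => c | S _ => 0 end) x c.
Proof.
  apply filterlim_ext with (fun _ => c); [|apply filterlim_const].
  intros n; induction n as [|n IH].
  - rewrite sum_O. unfold scal; simpl; unfold mult; simpl. unfold one; simpl. ring.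
  - rewrite sum_Sn, <- IH. unfold scal, plus; simpl; unfold mult; simpl. ring.
Qed.

(** The constant 6 is shifted twice, so that the sum follows from two uses of
    [is_pseries_incr_1]. *)
Definition monomial_6_2 : nat -> R :=
  PS_incr_1 (PS_incr_1 (fun n => match n with O => 6 | S _ => 0 end)).

Lemma is_pseries_monomial_6_2 (x : R) : is_pseries monomial_6_2 x (6 * x ^ 2).
Proof.
  replace (6 * x ^ 2) with (scal x (scal x 6))
    by (unfold scal; simpl; unfold mult; simpl; ring).
  do 2 apply (is_pseries_incr_1 (V := R_NormedModule)). apply is_pseries_const.
Qed.

Lemma is_pseries_derivative (a : nat -> R) (f : R -> R) (r x l : R) :
  (forall y, Rabs y < r -> is_pseries a y (f y)) ->
  Rabs x < r -> is_derive f x l ->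
  Rbar_lt (Rabs x) (CV_radius a) /\ is_pseries (PS_derive a) x l.
Proof.
  intros Ha Hx Hf.
  assert (Hcv : Rbar_lt (Rabs x) (CV_radius a)).
  (* Convergence at the midpoint of [Rabs x] and [r] places [x] strictly inside the disc of
     convergence. *)
  { pose proof (Rabs_pos x). set (y := (Rabs x + r) / 2).
    assert (Hy : Rabs y = y) by (apply Rabs_pos_eq; unfold y; lra).
    apply Rbar_lt_le_trans with (Rabs y); [rewrite Hy; simpl; unfold y; lra|].
    apply CV_radius_ge. exists (f y). apply Ha. rewrite Hy; unfold y; lra. }
  split; [exact Hcv|].
  replace l with (Derive (PSeries a) x); [now apply is_pseries_derive|].
  apply is_derive_unique. revert Hf. apply is_derive_ext_loc.
  assert (Hd : 0 < r - Rabs x) by lra.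
  exists (mkposreal _ Hd). intros y Hy.
  change (Rabs (y - x) < r - Rabs x) in Hy.
  symmetry; apply is_pseries_unique, Ha.
  replace y with ((y - x) + x) by ring.
  eapply Rle_lt_trans; [apply Rabs_triang|]. lra.
Qed.


(** * The recursion for the Taylor coefficients *)

(** These are the real and imaginary parts of [g g' = tau g' + 6 tau^2], compared coefficientwise
    for real [tau]; [PS_incr_1] is multiplication by [tau]. *)
Lemma solution_coefficients (eps : R) (g : C -> C) (a : nat -> C) :
  holomorphic_solution eps g -> taylor_coefficients g a ->
  let u n := Re (a n) in let v n := Im (a n) in
  u 0%nat = eps /\ v 0%nat = 0 /\
  forall n,
    PS_mult u (PS_derive u) n - PS_mult v (PS_derive v) n
      = PS_incr_1 (PS_derive u) n + monomial_6_2 n /\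
    PS_mult u (PS_derive v) n + PS_mult v (PS_derive u) n
      = PS_incr_1 (PS_derive v) n.
Proof.
  intros [Hg0 [r1 [Hr1 Hode]]] [r2 [Hr2 Hser]] u v.
  set (r := Rmin r1 r2).
  assert (Hr : 0 < r) by now apply Rmin_pos.
  assert (Hx1 : forall x, Rabs x < r -> Cmod (RtoC x) < r1).
  { intros x Hx. rewrite Cmod_R. eapply Rlt_le_trans; [exact Hx|apply Rmin_l]. }
  assert (Huv : forall x, Rabs x < r ->
    is_pseries u x (Re (g (RtoC x))) /\ is_pseries v x (Im (g (RtoC x)))).
  { intros x Hx. apply is_pseries_C_parts, Hser. rewrite Cmod_R.
    eapply Rlt_le_trans; [exact Hx|apply Rmin_r]. }
  assert (H0 : Rabs 0 < r) by now rewrite Rabs_R0.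
  destruct (Huv 0 H0) as [Hu0 Hv0].
  apply is_pseries_unique in Hu0. apply is_pseries_unique in Hv0.
  rewrite PSeries_0, Hg0 in Hu0. rewrite PSeries_0, Hg0 in Hv0.
  split; [exact Hu0|]. split; [exact Hv0|].
  (* [D] is the value of [g'] on the real axis; multiplying by [g - tau], which does not vanish,
     clears its denominator. *)
  set (D := fun x : R =>
    (RtoC 6 * RtoC x ^ 2 / (g (RtoC x) - RtoC x))%C).
  assert (HD : forall x, Rabs x < r ->
    Re (g x) * Re (D x) - Im (g x) * Im (D x) = x * Re (D x) + 6 * x ^ 2 /\
    Re (g x) * Im (D x) + Im (g x) * Re (D x) = x * Im (D x)).
  { intros x Hx. destruct (Hode _ (Hx1 x Hx)) as [Hne _].
    assert (E : ((g x - x) * D x = RtoC (6 * x ^ 2))%C).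
    { unfold D. replace (RtoC (6 * x ^ 2)) with (RtoC 6 * RtoC x ^ 2)%C
        by now rewrite RtoC_mult, RtoC_pow.
      field. intros E. apply Hne.
      replace (g x) with (g x - x + x)%C by ring. rewrite E. ring. }
    pose proof (f_equal Re E) as E1. pose proof (f_equal Im E) as E2.
    unfold Re, Im in *. simpl in E1, E2 |- *. lra. }
  assert (Hall : forall x, Rabs x < r ->
    (Rbar_lt (Rabs x) (CV_radius u) /\ is_pseries (PS_derive u) x (Re (D x))) /\
    (Rbar_lt (Rabs x) (CV_radius v) /\ is_pseries (PS_derive v) x (Im (D x)))).
  { intros x Hx. destruct (Hode _ (Hx1 x Hx)) as [_ Hd].
    destruct (is_derive_C_parts _ _ _ Hd) as [Hdu Hdv].
    split; eapply is_pseries_derivative; try eassumption; intros; now apply Huv. }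
  intros n; split.
  - apply (is_pseries_coef_unique
      (PS_minus (PS_mult u (PS_derive u)) (PS_mult v (PS_derive v)))
      (PS_plus (PS_incr_1 (PS_derive u)) monomial_6_2)
      (fun x => x * Re (D x) + 6 * x ^ 2) r); auto; intros x Hx;
      destruct (Huv x Hx) as [Hu Hv], (Hall x Hx) as [[Ru Hdu] [Rv Hdv]].
    + rewrite <- (proj1 (HD x Hx)).
      apply (is_pseries_minus (V := R_NormedModule)); apply is_pseries_mult;
        rewrite ?CV_radius_derive; assumption.
    + apply (is_pseries_plus (V := R_NormedModule)).
      * now apply (is_pseries_incr_1 (V := R_NormedModule)).
      * apply is_pseries_monomial_6_2.
  - apply (is_pseries_coef_unique
      (PS_plus (PS_mult u (PS_derive v)) (PS_mult v (PS_derive u)))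
      (PS_incr_1 (PS_derive v))
      (fun x => x * Im (D x)) r); auto; intros x Hx;
      destruct (Huv x Hx) as [Hu Hv], (Hall x Hx) as [[Ru Hdu] [Rv Hdv]].
    + rewrite <- (proj2 (HD x Hx)).
      apply (is_pseries_plus (V := R_NormedModule)); apply is_pseries_mult;
        rewrite ?CV_radius_derive; assumption.
    + now apply (is_pseries_incr_1 (V := R_NormedModule)).
Qed.

(** * Majorization: Cauchy products, the norm recursion and its weighted sums *)

(** The product of the partial sums exceeds the partial sum of the Cauchy product by a sum of
    nonnegative cross terms. [cauchy_finite] requires a positive index, hence the separate case
    0. *)
Lemma sum_cauchy_le (c d : nat -> R) (N : nat) :
  (forall n, 0 <= c n) -> (forall n, 0 <= d n) ->
  sum_f_R0 (PS_mult c d) N <= sum_f_R0 c N * sum_f_R0 d N.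
Proof.
  intros Hc Hd. destruct N as [|N]; [apply Rle_refl|].
  rewrite (cauchy_finite c d (S N)) by lia.
  rewrite <- (Rplus_0_r (sum_f_R0 (PS_mult c d) (S N))).
  apply Rplus_le_compat_l.
  do 2 (apply cond_pos_sum; intros). now apply Rmult_le_pos.
Qed.

(** Splitting off the leading coefficient isolates the derivative coefficient of highest index, for
    which the recursion is then solved. *)
Lemma PS_mult_S (a b : nat -> R) (n : nat) :
  PS_mult a b (S n) = a 0%nat * b (S n) + PS_mult (PS_decr_1 a) b n.
Proof. unfold PS_mult. now rewrite decomp_sum by lia. Qed.

(** The norm [|Re z| + |Im z|] is submultiplicative on complex numbers; this is its version for
    Cauchy products of [u + i v] and [x + i y]. *)
Lemma PS_mult_complex_le (u v x y : nat -> R) (n : nat) :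
  Rabs (PS_mult u x n - PS_mult v y n) + Rabs (PS_mult u y n + PS_mult v x n) <=
  PS_mult (fun k => Rabs (u k) + Rabs (v k)) (fun k => Rabs (x k) + Rabs (y k)) n.
Proof.
  assert (H : forall a b, Rabs (PS_mult a b n) <=
                PS_mult (fun k => Rabs (a k)) (fun k => Rabs (b k)) n).
  { intros a b. unfold PS_mult. eapply Rle_trans; [apply Rsum_abs|].
    apply sum_Rle. intros k _. rewrite Rabs_mult. apply Rle_refl. }
  assert (E : PS_mult (fun k => Rabs (u k) + Rabs (v k))
                      (fun k => Rabs (x k) + Rabs (y k)) n =
    PS_mult (fun k => Rabs (u k)) (fun k => Rabs (x k)) n +
    PS_mult (fun k => Rabs (v k)) (fun k => Rabs (y k)) n +
    PS_mult (fun k => Rabs (u k)) (fun k => Rabs (y k)) n +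
    PS_mult (fun k => Rabs (v k)) (fun k => Rabs (x k)) n).
  { unfold PS_mult. rewrite <- !sum_plus. apply sum_eq. intros; ring. }
  rewrite E.
  pose proof (H u x). pose proof (H v y). pose proof (H u y). pose proof (H v x).
  pose proof (Rabs_triang (PS_mult u x n) (- PS_mult v y n)) as T1.
  rewrite Rabs_Ropp in T1.
  pose proof (Rabs_triang (PS_mult u y n) (PS_mult v x n)).
  unfold Rminus. lra.
Qed.

(** Since [a 0] is the positive real [eps], the highest term enters as [eps] times a derivative
    coefficient; the triangle inequality bounds the rest. *)
Lemma solution_coefficients_norm (eps : R) (g : C -> C) (a : nat -> C) :
  0 < eps -> holomorphic_solution eps g -> taylor_coefficients g a ->
  let m n := Rabs (Re (a n)) + Rabs (Im (a n)) in
  PS_derive m 0%nat = 0 /\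
  forall n, eps * PS_derive m (S n) <=
    PS_derive m n + monomial_6_2 (S n) + PS_mult (PS_decr_1 m) (PS_derive m) n.
Proof.
  intros Heps Hg Ha m.
  destruct (solution_coefficients _ _ _ Hg Ha) as [Hu0 [Hv0 Hrec]].
  set (u := fun n => Re (a n)) in *. set (v := fun n => Im (a n)) in *.
  cbv beta in Hrec.
  assert (Hm : forall n, PS_derive m n = Rabs (PS_derive u n) + Rabs (PS_derive v n)).
  { intros n. unfold PS_derive. rewrite !Rabs_mult, (Rabs_pos_eq (INR _)) by apply pos_INR.
    unfold m, u, v. ring. }
  change (u 0%nat = eps) in Hu0. change (v 0%nat = 0) in Hv0.
  split.
  (* At index 0 the right-hand sides vanish, so [eps] times the first coefficient is 0. *)
  - destruct (Hrec 0%nat) as [E1 E2].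
    change (u 0%nat * PS_derive u 0 - v 0%nat * PS_derive v 0 = 0 + 0) in E1.
    change (u 0%nat * PS_derive v 0 + v 0%nat * PS_derive u 0 = 0) in E2.
    rewrite Hu0, Hv0 in E1, E2. rewrite Hm.
    assert (PS_derive u 0 = 0) as -> by nra.
    assert (PS_derive v 0 = 0) as -> by nra.
    rewrite Rabs_R0; ring.
  - intros n. destruct (Hrec (S n)) as [E1 E2].
    rewrite !PS_mult_S, Hu0, Hv0 in E1, E2.
    change (PS_incr_1 (PS_derive u) (S n)) with (PS_derive u n) in E1.
    change (PS_incr_1 (PS_derive v) (S n)) with (PS_derive v n) in E2.
    pose proof (PS_mult_complex_le (PS_decr_1 u) (PS_decr_1 v)
                  (PS_derive u) (PS_derive v) n) as B.
    assert (EB : PS_mult (PS_decr_1 m) (PS_derive m) n =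
      PS_mult (fun k => Rabs (PS_decr_1 u k) + Rabs (PS_decr_1 v k))
              (fun k => Rabs (PS_derive u k) + Rabs (PS_derive v k)) n).
    { unfold PS_mult. apply sum_eq. intros i _. now rewrite Hm. }
    rewrite EB, !Hm. clear EB.
    (* [X] and [Y] are the real and imaginary parts of the Cauchy product left after removing the
       [eps] term. *)
    set (X := PS_mult (PS_decr_1 u) (PS_derive u) n - _) in B.
    set (Y := PS_mult (PS_decr_1 u) (PS_derive v) n + _) in B.
    assert (Hp : 0 <= monomial_6_2 (S n)).
    { destruct n as [|[|n]]; unfold monomial_6_2, PS_incr_1, zero; simpl; lra. }
    assert (F1 : eps * PS_derive u (S n) = PS_derive u n + monomial_6_2 (S n) - X)
      by (unfold X; lra).
    assert (F2 : eps * PS_derive v (S n) = PS_derive v n - Y) by (unfold Y; lra).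
    assert (G : forall z, eps * Rabs z = Rabs (eps * z)).
    { intros z. now rewrite Rabs_mult, (Rabs_pos_eq eps) by lra. }
    rewrite Rmult_plus_distr_l, !G, F1, F2.
    pose proof (Rabs_triang (PS_derive u n + monomial_6_2 (S n)) (- X)).
    pose proof (Rabs_triang (PS_derive u n) (monomial_6_2 (S n))).
    pose proof (Rabs_triang (PS_derive v n) (- Y)).
    rewrite (Rabs_pos_eq _ Hp) in *. rewrite Rabs_Ropp in *.
    unfold Rminus. lra.
Qed.

(* Multiplying the recursion by [s^(n+2)] and summing gives
   [eps D_(N+1) <= 6 s^3 + s D_N + D_N^2] for the partial sums [D_N]. The level
   [(eps - s) / 2] minimizes [D^2 - (eps - s) D], so it is preserved by this
   recursion for the largest possible range of [s]. *)
Lemma weighted_sum_bound (eps s : R) (m : nat -> R) :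
  0 <= s -> s < eps -> 24 * s ^ 3 <= (eps - s) ^ 2 ->
  (forall n, 0 <= m n) -> PS_derive m 0%nat = 0 ->
  (forall n, eps * PS_derive m (S n) <=
    PS_derive m n + monomial_6_2 (S n) + PS_mult (PS_decr_1 m) (PS_derive m) n) ->
  forall N, sum_f_R0 (fun n => PS_derive m n * s ^ S n) N <= (eps - s) / 2.
Proof.
  intros Hs Hse Hs3 Hm Hm0 Hrec.
  set (d := fun n => PS_derive m n * s ^ S n).
  set (e := fun n => PS_decr_1 m n * s ^ S n).
  assert (Hpow : forall n, 0 <= s ^ n) by (intros; now apply pow_le).
  assert (He : forall n, 0 <= e n) by (intros; now apply Rmult_le_pos; [apply Hm|]).
  assert (Hed : forall n, e n <= d n).
  { intros n. apply Rmult_le_compat_r; [apply Hpow|].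
    unfold PS_decr_1, PS_derive. rewrite S_INR.
    pose proof (Hm (S n)). pose proof (pos_INR n). nra. }
  assert (Hd : forall n, 0 <= d n) by (intros n; eapply Rle_trans; [apply He|apply Hed]).
  assert (Hstep : forall n, eps * d (S n) <=
            s * d n + monomial_6_2 (S n) * s ^ S (S n) + PS_mult e d n).
  { intros n.
    (* The weights [s^(k+1)] and [s^(n-k+1)] multiply to [s^(n+2)], the weight of [d (S n)]. *)
    assert (E : PS_mult e d n = PS_mult (PS_decr_1 m) (PS_derive m) n * s ^ S (S n)).
    { unfold PS_mult. rewrite Rmult_comm, scal_sum. apply sum_eq. intros k Hk.
      unfold e, d. replace (S (S n)) with (S k + S (n - k))%nat by lia.
      rewrite pow_add. ring. }
    rewrite E. pose proof (Rmult_le_compat_r _ _ _ (Hpow (S (S n))) (Hrec n)) as H.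
    unfold d. replace (s ^ S (S n)) with (s * s ^ S n) in * by reflexivity. lra. }
  (* Only the summand [n = 1] is nonzero, and it equals [6 s^3]. *)
  assert (Hmono : forall N,
            sum_f_R0 (fun n => monomial_6_2 (S n) * s ^ S (S n)) N <= 6 * s ^ 3).
  { assert (Hmono0 : forall n, monomial_6_2 (S (S (S n))) = 0) by reflexivity.
    assert (Hmono1 : forall N,
      sum_f_R0 (fun n => monomial_6_2 (S n) * s ^ S (S n)) (S N) = 6 * s ^ 3).
    { induction N as [|N IH].
      - unfold monomial_6_2, PS_incr_1, zero; simpl. ring.
      - rewrite tech5, IH, Hmono0. ring. }
    intros [|N]; [|rewrite Hmono1; apply Rle_refl].
    pose proof (Hpow 3%nat). unfold monomial_6_2, PS_incr_1, zero; simpl in *. lra. }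
  induction N as [|N IH].
  - change (PS_derive m 0 * s ^ 1 <= (eps - s) / 2). rewrite Hm0. lra.
  - rewrite decomp_sum by lia. simpl pred.
    change (d 0%nat + sum_f_R0 (fun n => d (S n)) N <= (eps - s) / 2).
    replace (d 0%nat) with 0 by (unfold d; rewrite Hm0; ring).
    assert (H : eps * sum_f_R0 (fun n => d (S n)) N <=
      s * sum_f_R0 d N + 6 * s ^ 3 + sum_f_R0 e N * sum_f_R0 d N).
    { rewrite scal_sum. eapply Rle_trans.
      - apply sum_Rle. intros n _. rewrite Rmult_comm. apply Hstep.
      - rewrite !sum_plus. pose proof (Hmono N).
        pose proof (sum_cauchy_le e d N He Hd).
        replace (sum_f_R0 (fun n => s * d n) N) with (s * sum_f_R0 d N)
          by (rewrite scal_sum; apply sum_eq; intros; ring).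
        change (fun n => PS_mult e d n) with (PS_mult e d). lra. }
    assert (HeD : sum_f_R0 e N <= sum_f_R0 d N) by (apply sum_Rle; auto).
    assert (HD0 : 0 <= sum_f_R0 d N) by now apply cond_pos_sum.
    (* With [L = (eps - s) / 2], the bound [s L + 6 s^3 + L^2 <= eps L] is exactly
       [24 s^3 <= (eps - s)^2]; the left side increases with [L >= 0]. *)
    fold d in IH. apply (Rmult_le_reg_l eps); [lra|]. nra.
Qed.

(** * Convergence on the disc and the choice of the radius *)

(** Comparison with a geometric series of ratio [Cmod tau / s]. *)
Lemma ex_pseries_of_weighted_bound (a : nat -> C) (M s : R) (tau : C) :
  (forall n, Cmod (a n) * s ^ n <= M) -> Cmod tau < s ->
  ex_pseries (V := C_NormedModule) a tau.
Proof.
  intros HM Hlt. pose proof (Cmod_ge_0 tau) as H0.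
  apply (ex_series_le (V := C_CompleteNormedModule) _ (fun n => M * (Cmod tau / s) ^ n)).
  - intros n.
    assert (E : pow_n (K := C_AbsRing) tau n = (tau ^ n)%C).
    { induction n as [|n IH]; [reflexivity|]. simpl. now rewrite IH. }
    rewrite E. change (Cmod (tau ^ n * a n) <= M * (Cmod tau / s) ^ n).
    rewrite Cmod_mult, Cmod_pow. unfold Rdiv. rewrite Rpow_mult_distr, pow_inv.
    assert (Hs : 0 < s ^ n) by (apply pow_lt; lra).
    replace (Cmod tau ^ n * Cmod (a n))
      with ((Cmod (a n) * s ^ n) * (Cmod tau ^ n * / s ^ n)) by (field; lra).
    apply Rmult_le_compat_r; [|apply HM].
    apply Rmult_le_pos; [now apply pow_le|]. now apply Rlt_le, Rinv_0_lt_compat.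
  - apply (ex_series_scal (K := R_AbsRing) (V := R_NormedModule) M). apply ex_series_geom.
    rewrite Rabs_pos_eq by (apply Rdiv_le_0_compat; lra).
    apply Rlt_div_l; lra.
Qed.

Lemma solution_ex_pseries (eps s : R) (g : C -> C) (a : nat -> C) (tau : C) :
  holomorphic_solution eps g -> taylor_coefficients g a ->
  s < eps -> 24 * s ^ 3 <= (eps - s) ^ 2 -> Cmod tau < s ->
  ex_pseries (V := C_NormedModule) a tau.
Proof.
  intros Hg Ha Hse Hs3 Htau.
  assert (Hs : 0 <= s) by (pose proof (Cmod_ge_0 tau); lra).
  destruct (solution_coefficients_norm eps g a ltac:(lra) Hg Ha) as [Hm0 Hrec].
  set (m := fun n => Rabs (Re (a n)) + Rabs (Im (a n))) in *.
  assert (Hm : forall n, 0 <= m n).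
  { intros n. pose proof (Rabs_pos (Re (a n))). pose proof (Rabs_pos (Im (a n))).
    unfold m. lra. }
  assert (Ham : forall n, Cmod (a n) <= m n).
  { intros n. unfold m.
    replace (a n) with (RtoC (Re (a n)) + Ci * RtoC (Im (a n)))%C at 1
      by (destruct (a n); unfold Ci, Re, Im, RtoC, Cplus, Cmult; simpl; f_equal; ring).
    eapply Rle_trans; [apply Cmod_triangle|].
    rewrite Cmod_mult, !Cmod_R, Cmod_Ci. lra. }
  pose proof (weighted_sum_bound eps s m Hs Hse Hs3 Hm Hm0 Hrec) as HD.
  (* The summand [m 0] covers index 0; a positive index contributes one nonnegative term of a sum
     bounded by [(eps - s) / 2]. *)
  apply (ex_pseries_of_weighted_bound a (m 0%nat + (eps - s) / 2) s); [|exact Htau].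
  intros n. assert (Hp : 0 <= s ^ n) by now apply pow_le.
  apply Rle_trans with (m n * s ^ n); [now apply Rmult_le_compat_r|].
  destruct n as [|n]; [simpl; lra|].
  apply Rle_trans with (PS_derive m n * s ^ S n).
  - apply Rmult_le_compat_r; [exact Hp|].
    unfold PS_derive. rewrite S_INR. pose proof (Hm (S n)). pose proof (pos_INR n). nra.
  - apply Rle_trans with ((eps - s) / 2); [|pose proof (Hm 0%nat); lra].
    eapply Rle_trans; [|apply (HD n)].
    destruct n as [|n]; [apply Rle_refl|]. rewrite tech5.
    assert (0 <= sum_f_R0 (fun n => PS_derive m n * s ^ S n) n); [|lra].
    apply cond_pos_sum. intros k. apply Rmult_le_pos; [|now apply pow_le].
    apply Rmult_le_pos; [apply pos_INR|apply Hm].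
Qed.

Theorem theorem3 :
  exists r : R -> R,
    little_o_at_right_0 (fun eps => r eps - eps ^ 3) (fun eps => eps ^ 3) /\
    forall (eps : R) (g : C -> C) (a : nat -> C),
      0 < eps ->
      holomorphic_solution eps g ->
      taylor_coefficients g a ->
      forall t tau : C,
        (tau ^ 3)%C = t -> Cmod t < r eps -> ex_pseries a tau.
Proof.
  (* With [s = eps (1 - sqrt (24 eps))], [(eps - s)^2 = 24 eps^3], which is at least [24 s^3] when
     [0 <= s <= eps]. For [24 eps >= 1] the radius is not positive and the claim is vacuous. *)
  exists (fun eps => (eps * (1 - sqrt (24 * eps))) ^ 3). split.
  (* Below [1 / 24] one has [q <= 1], and below [e^2 / 216] one has [3 q <= e]; the relative error
     [1 - (1 - q)^3] is then at most [3 q]. *)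
  - intros [e He]. set (b := Rmin (1 / 24) (e ^ 2 / 216)).
    assert (Hb : 0 < b) by (apply Rmin_pos; [lra|]; apply Rdiv_lt_0_compat; nra).
    exists (mkposreal b Hb). intros x Hx Hx0.
    change (Rabs (x - 0) < b) in Hx. rewrite Rminus_0_r, Rabs_pos_eq in Hx by lra.
    pose proof (Rlt_le_trans _ _ _ Hx (Rmin_l _ _)).
    pose proof (Rlt_le_trans _ _ _ Hx (Rmin_r _ _)).
    assert (Hq : sqrt (24 * x) * sqrt (24 * x) = 24 * x) by (apply sqrt_sqrt; lra).
    pose proof (sqrt_pos (24 * x)) as Hq0. set (q := sqrt (24 * x)) in *.
    assert (Hq1 : q <= 1) by nra.
    assert (Hqe : 3 * q <= e) by nra.
    change (Rabs ((x * (1 - q)) ^ 3 - x ^ 3) <= e * Rabs (x ^ 3)).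
    assert (Hx3 : 0 < x ^ 3) by now apply pow_lt.
    rewrite (Rabs_pos_eq (x ^ 3)) by lra.
    replace ((x * (1 - q)) ^ 3 - x ^ 3) with (- (x ^ 3 * (q * (3 - 3 * q + q * q)))) by ring.
    rewrite Rabs_Ropp, Rabs_pos_eq by (apply Rmult_le_pos; nra).
    rewrite (Rmult_comm e). apply Rmult_le_compat_l; [lra|]. nra.
  - intros eps g a Heps Hg Ha t tau <- Ht. rewrite Cmod_pow in Ht.
    assert (Hq : sqrt (24 * eps) * sqrt (24 * eps) = 24 * eps) by (apply sqrt_sqrt; lra).
    assert (Hq0 : 0 < sqrt (24 * eps)) by (apply sqrt_lt_R0; lra).
    set (q := sqrt (24 * eps)) in *. set (s := eps * (1 - q)) in *.
    pose proof (Cmod_ge_0 tau) as Htau.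
    (* Cube roots are taken by contradiction; a negative [s] would give
       [s^3 <= 0 <= Cmod tau ^ 3]. *)
    assert (Hlt : Cmod tau < s).
    { apply Rnot_le_lt. intros Hle. apply (Rlt_irrefl (s ^ 3)).
      eapply Rle_lt_trans; [|exact Ht].
      pose proof (pow_le _ 2 Htau). destruct (Rle_dec 0 s) as [Hs|Hs].
      - now apply pow_incr.
      - apply Rle_trans with 0; [|now apply pow_le]. simpl. nra. }
    apply (solution_ex_pseries eps s g a tau Hg Ha); [unfold s; nra| |exact Hlt].
    assert (Hs : 0 < 1 - q) by (unfold s in Hlt; nra).
    replace ((eps - s) ^ 2) with (24 * eps ^ 3) by (unfold s; simpl; nra).
    apply Rmult_le_compat_l; [lra|]. apply pow_incr. unfold s. nra.
Qed.
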